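(* Let $M,N$ be $L$-structures with $M\equiv N$. Then there are charge spaces $(I,\mathcal A,\mu)$ and $(J,\mathcal B,\nu)$ such that $M$ is $\mathcal A$-meanable, $N$ is $\mathcal B$-meanable, and $M^\mu\simeq N^\nu$.
   Context: Affine continuous logic: $L$ a Lipschitz language; structures are complete metric spaces of diameter $\le1$ with Lipschitz interpretations; affine formulas are built from atomic $1,d(t_1,t_2),R(\bar t)$ by $+$, real scalars, $\sup$, $\inf$. $M\equiv N$ means $\sigma^M=\sigma^N$ for all affine sentences $\sigma$. A charge space $(I,\mathcal A,\mu)$: $\mathcal A$ a Boolean algebra of subsets of $I$, $\mu$ a finitely additive probability on $\mathcal A$. $w(M)$ is the least size of a base of $M$'s topology plus $\aleph_0$; $M$ is $\mathcal A$-meanable if $M$ is finite or $\mathcal A$ is closed under intersections of at most $w(M)$ members. $M^\mu$: classes of maps $a:I\to M$ with $a^{-1}(B)\in\mathcal A$ for Borel $B$, modulo $\int d(a_i,b_i)d\mu=0$, with metric $\int d(a_i,b_i)d\mu$, constants and functions computed pointwise, and $R^{M^\mu}([a_i],\dots)=\int R^M(a_i,\dots)d\mu$. $\simeq$ denotes isomorphism of $L$-structures. *)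

(* Defs.v *)
From Stdlib Require Import Reals Lra List ClassicalEpsilon.
From Stdlib Require Fin.
From Coquelicot Require Import Coquelicot.
Open Scope R_scope.

Record Lang := {
  Fsym : Type;
  Rsym : Type;
  farity : Fsym -> nat;
  rarity : Rsym -> nat;
  flip : Fsym -> R;
  rlip : Rsym -> R;
  rbound : Rsym -> R
}.

Record Lstruc (L : Lang) := {
  car :> Type;
  dist : car -> car -> R;
  car_inhab : inhabited car;
  dist_nonneg : forall x y, 0 <= dist x y;
  dist_le1 : forall x y, dist x y <= 1;
  dist_refl : forall x, dist x x = 0;
  dist_sep : forall x y, dist x y = 0 -> x = y;
  dist_sym : forall x y, dist x y = dist y x;
  dist_tri : forall x y z, dist x z <= dist x y + dist y z;
  dist_complete : forall u : nat -> car,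
    (forall eps, 0 < eps -> exists N, forall m n, (N <= m)%nat -> (N <= n)%nat ->
       dist (u m) (u n) < eps) ->
    exists x, forall eps, 0 < eps -> exists N, forall n, (N <= n)%nat -> dist (u n) x < eps;
  funs : forall f : Fsym L, (Fin.t (farity L f) -> car) -> car;
  rels : forall P : Rsym L, (Fin.t (rarity L P) -> car) -> R;
  funs_lip : forall f (x y : Fin.t (farity L f) -> car) e,
    (forall k, dist (x k) (y k) <= e) -> dist (funs f x) (funs f y) <= flip L f * e;
  rels_lip : forall P (x y : Fin.t (rarity L P) -> car) e,
    (forall k, dist (x k) (y k) <= e) -> Rabs (rels P x - rels P y) <= rlip L P * e;
  rels_bound : forall P x, Rabs (rels P x) <= rbound L P
}.
Arguments dist {L} _ _ _.
Arguments funs {L} _ _ _.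
Arguments rels {L} _ _ _.

Inductive term (L : Lang) : Type :=
| tvar : nat -> term L
| tapp : forall f : Fsym L, (Fin.t (farity L f) -> term L) -> term L.
Arguments tvar {L} _.
Arguments tapp {L} _ _.

Inductive formula (L : Lang) : Type :=
| fone : formula L
| fdist : term L -> term L -> formula L
| frel : forall P : Rsym L, (Fin.t (rarity L P) -> term L) -> formula L
| fadd : formula L -> formula L -> formula L
| fscale : R -> formula L -> formula L
| fsup : nat -> formula L -> formula L
| finf : nat -> formula L -> formula L.
Arguments fone {L}.
Arguments fdist {L} _ _.
Arguments frel {L} _ _.
Arguments fadd {L} _ _.
Arguments fscale {L} _ _.
Arguments fsup {L} _ _.
Arguments finf {L} _ _.

Fixpoint occurs {L} (n : nat) (t : term L) : Prop :=
  match t with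
  | tvar m => n = m
  | tapp f args => exists k, occurs n (args k)
  end.

Fixpoint free {L} (n : nat) (phi : formula L) : Prop :=
  match phi with
  | fone => False
  | fdist t1 t2 => occurs n t1 \/ occurs n t2
  | frel P args => exists k, occurs n (args k)
  | fadd p q => free n p \/ free n q
  | fscale _ p => free n p
  | fsup x p => n <> x /\ free n p
  | finf x p => n <> x /\ free n p
  end.

Definition sentence {L} (phi : formula L) : Prop := forall n, ~ free n phi.

Fixpoint teval {L} (M : Lstruc L) (s : nat -> M) (t : term L) : M :=
  match t with
  | tvar n => s n
  | tapp f args => funs M f (fun k => teval M s (args k))
  end.

Definition upd {X : Type} (s : nat -> X) (x : nat) (a : X) : nat -> X :=
  fun n => if Nat.eqb n x then a else s n.

Fixpoint feval {L} (M : Lstruc L) (s : nat -> M) (phi : formula L) : R :=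
  match phi with
  | fone => 1
  | fdist t1 t2 => dist M (teval M s t1) (teval M s t2)
  | frel P args => rels M P (fun k => teval M s (args k))
  | fadd p q => feval M s p + feval M s q
  | fscale r p => r * feval M s p
  | fsup x p => real (Lub_Rbar (fun r => exists a : M, r = feval M (upd s x a) p))
  | finf x p => real (Glb_Rbar (fun r => exists a : M, r = feval M (upd s x a) p))
  end.

(* affine elementary equivalence M ≡ N: every affine sentence takes the same
   value in M and in N (the value of a sentence does not depend on the assignment) *)
Definition aff_equiv {L} (M N : Lstruc L) : Prop :=
  forall phi : formula L, sentence phi ->
    forall (sM : nat -> M) (sN : nat -> N), feval M sM phi = feval N sN phi.

Record charge_space := {
  cI : Type;
  cA : (cI -> Prop) -> Prop;
  cA_full : cA (fun _ => True);
  cA_compl : forall S, cA S -> cA (fun i => ~ S i);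
  cA_union : forall S T, cA S -> cA T -> cA (fun i => S i \/ T i);
  cmu : (cI -> Prop) -> R;
  cmu_nonneg : forall S, cA S -> 0 <= cmu S;
  cmu_full : cmu (fun _ => True) = 1;
  cmu_add : forall S T, cA S -> cA T -> (forall i, S i -> T i -> False) ->
    cmu (fun i => S i \/ T i) = cmu S + cmu T
}.

Definition indic {X : Type} (S : X -> Prop) (x : X) : R :=
  if excluded_middle_informative (S x) then 1 else 0.

Fixpoint simple_val {X : Type} (l : list (R * (X -> Prop))) (x : X) : R :=
  match l with
  | nil => 0
  | (c, E) :: l' => c * indic E x + simple_val l' x
  end.

Fixpoint simple_int (mu : charge_space) (l : list (R * (cI mu -> Prop))) : R :=
  match l with
  | nil => 0
  | (c, E) :: l' => c * cmu mu E + simple_int mu l'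
  end.

(* ∫ f dμ for bounded A-measurable f : supremum of the integrals of A-simple
   functions below f *)
Definition integral (mu : charge_space) (f : cI mu -> R) : R :=
  real (Lub_Rbar (fun r => exists l : list (R * (cI mu -> Prop)),
      (forall c S, In (c, S) l -> cA mu S) /\
      (forall i, simple_val l i <= f i) /\ r = simple_int mu l)).

Definition mopen {L} (M : Lstruc L) (U : M -> Prop) : Prop :=
  forall x, U x -> exists eps, 0 < eps /\ forall y, dist M x y < eps -> U y.

Definition is_base {L} (M : Lstruc L) (B : (M -> Prop) -> Prop) : Prop :=
  (forall U, B U -> mopen M U) /\
  (forall U, mopen M U -> forall x, U x -> exists V, B V /\ V x /\ forall y, V y -> U y).

Definition sigma_alg {X : Type} (S : (X -> Prop) -> Prop) : Prop :=
  S (fun _ => True) /\ (forall B, S B -> S (fun x => ~ B x)) /\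
  (forall Bn : nat -> X -> Prop, (forall n, S (Bn n)) -> S (fun x => exists n, Bn n x)).

Definition borel {L} (M : Lstruc L) (B : M -> Prop) : Prop :=
  forall S, sigma_alg S -> (forall U, mopen M U -> S U) -> S B.

(* |K| <= w(M) = (least size of a base) + aleph_0,
   i.e. for every base B, K injects into B ⊔ ℕ *)
Definition card_le_weight {L} (K : Type) (M : Lstruc L) : Prop :=
  forall B, is_base M B ->
    exists g : K -> ((M -> Prop) + nat),
      (forall k1 k2, g k1 = g k2 -> k1 = k2) /\
      (forall k, match g k with inl U => B U | inr _ => True end).

Definition finite_struc {L} (M : Lstruc L) : Prop :=
  exists l : list M, forall x, In x l.

Definition meanable {L} (M : Lstruc L) (mu : charge_space) : Prop :=
  finite_struc M \/
  (forall (K : Type) (F : K -> cI mu -> Prop), card_le_weight K M ->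
     (forall k, cA mu (F k)) -> cA mu (fun i => forall k, F k i)).

(* elements of M^mu are classes of A-measurable maps I -> M *)
Definition cmeas {L} (M : Lstruc L) (mu : charge_space) (a : cI mu -> M) : Prop :=
  forall B, borel M B -> cA mu (fun i => B (a i)).

(* M^mu ≃ N^nu : an isomorphism of the quotient structures, presented by a map
   on representatives.  Phi is well defined on classes and injective because it
   preserves the metric ∫ d(a_i,b_i) dμ; it is onto the classes; it commutes with
   the pointwise interpretation of function symbols (incl. constants) up to the
   null relation, and preserves R^{M^mu}([a]) = ∫ R^M(a_i) dμ. *)
Definition pow_iso {L} (M : Lstruc L) (mu : charge_space) (N : Lstruc L) (nu : charge_space)
  : Prop :=
  exists Phi : (cI mu -> M) -> (cI nu -> N),
    (forall a, cmeas M mu a -> cmeas N nu (Phi a)) /\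
    (forall a b, cmeas M mu a -> cmeas M mu b ->
       integral nu (fun j => dist N (Phi a j) (Phi b j))
       = integral mu (fun i => dist M (a i) (b i))) /\
    (forall b, cmeas N nu b -> exists a, cmeas M mu a /\
       integral nu (fun j => dist N (Phi a j) (b j)) = 0) /\
    (forall (f : Fsym L) (a : Fin.t (farity L f) -> cI mu -> M),
       (forall k, cmeas M mu (a k)) ->
       integral nu (fun j => dist N (Phi (fun i => funs M f (fun k => a k i)) j)
                                    (funs N f (fun k => Phi (a k) j))) = 0) /\
    (forall (P : Rsym L) (a : Fin.t (rarity L P) -> cI mu -> M),
       (forall k, cmeas M mu (a k)) ->
       integral nu (fun j => rels N P (fun k => Phi (a k) j))
       = integral mu (fun i => rels M P (fun k => a k i))).

(* Main.v *)
(* Build formal terms [tree] freely from one generator and all infinitary operations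
   on the points of M and on the points of N. A valuation in M obeys the M-operations
   exactly and is arbitrary on the N-operations, and symmetrically in N. With the
   algebra of sets of valuations determined by "few" coordinates, the measurable maps
   to M are exactly the coordinates [v |-> v s], and likewise for N, so that matching
   the coordinate [s] in M with the coordinate [s] in N is the required isomorphism as
   soon as the two charges give every quantifier-free affine formula in the coordinates
   the same integral. By Hahn-Banach such charges exist unless some formula has
   supremum over the M-valuations strictly below its infimum over the N-valuations.
   This never happens: the outermost tree in a formula is unconstrained on one of the
   two sides, hence can be quantified away by [sup] or [inf], and the process ends with
   an affine sentence, which has the same value in M and in N. *)

Require Import Defs.
From Stdlib Require Import Reals Lra List Wf_nat ClassicalEpsilon.
From Stdlib Require Import FunctionalExtensionality PropExtensionality.
From Stdlib Require Fin.
From mathcomp Require classical_sets.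
From Coquelicot Require Import Coquelicot.
Open Scope R_scope.

(** * Bounded real functions and the Hahn-Banach theorem for means *)

Definition bounded {X : Type} (f : X -> R) : Prop :=
  exists C, forall x, Rabs (f x) <= C.

Lemma bounded_const {X : Type} (c : R) : bounded (fun _ : X => c).
Proof. exists (Rabs c); intros _; lra. Qed.

Lemma bounded_add {X : Type} (f g : X -> R) :
  bounded f -> bounded g -> bounded (fun x => f x + g x).
Proof.
  intros [C HC] [D HD]; exists (C + D); intros x.
  eapply Rle_trans; [apply Rabs_triang|]; apply Rplus_le_compat; auto.
Qed.

Lemma bounded_scale {X : Type} (t : R) (f : X -> R) :
  bounded f -> bounded (fun x => t * f x).
Proof.
  intros [C HC]; exists (Rabs t * C); intros x.
  rewrite Rabs_mult; apply Rmult_le_compat_l; auto using Rabs_pos.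
Qed.

Lemma bounded_comp {X Y : Type} (g : Y -> X) (f : X -> R) :
  bounded f -> bounded (fun y => f (g y)).
Proof. intros [C HC]; exists C; auto. Qed.

(* Graph of a partial linear functional dominated by the supremum; domination at
   the zero function makes the relation single-valued. *)
Definition dominated_graph {X : Type} (G : (X -> R) * R -> Prop) : Prop :=
  (forall p q, G p -> G q -> G (fun x => fst p x + fst q x, snd p + snd q)) /\
  (forall t p, G p -> G (fun x => t * fst p x, t * snd p)) /\
  (forall p c, G p -> (forall x, fst p x <= c) -> snd p <= c).

Lemma dominated_graph_ext {X : Type} (G H : (X -> R) * R -> Prop) :
  (forall p, G p <-> H p) -> dominated_graph G -> dominated_graph H.
Proof.
  intros E [HA [HS HD]]; split; [|split].
  - intros p q Hp Hq; apply E, HA; now apply E.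
  - intros t p Hp; apply E, HS; now apply E.
  - intros p c Hp; apply HD; now apply E.
Qed.

(** One Hahn-Banach step. Domination forces [s - c <= r0] whenever [g - f0 <= c], and [r0 <= c - s]
    whenever [g + f0 <= c]. Adding two such inequalities and using domination on [G] shows that
    every lower bound is below every upper bound, so the supremum of the lower bounds serves as
    [r0]. *)
Lemma dominated_graph_extend {X : Type} (G : (X -> R) * R -> Prop) (f0 : X -> R) :
  dominated_graph G -> G (fun _ => 0, 0) -> bounded f0 ->
  exists r0, dominated_graph (fun p => exists g s t,
    G (g, s) /\ p = (fun x => g x + t * f0 x, s + t * r0)).
Proof.
  intros [HA [HS HD]] G0 [C HC].
  set (E := fun r => exists g s c, G (g, s) /\ (forall x, g x - f0 x <= c) /\ r = s - c).
  assert (Hcons : forall g s c r, G (g, s) -> (forall x, g x + f0 x <= c) -> E r -> r <= c - s).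
  { intros g s c r Hg Hc [g' [s' [c' [Hg' [Hc' ->]]]]].
    pose proof (HD _ (c + c') (HA _ _ Hg Hg')) as H; simpl in H.
    assert (s + s' <= c + c'); [|lra].
    apply H; intros x; specialize (Hc x); specialize (Hc' x); lra. }
  destruct (completeness E) as [r0 [Hub Hlub]].
  - exists (C - 0); intros r Hr.
    apply (Hcons (fun _ => 0) 0 C r); auto.
    intros x; specialize (HC x); apply Rabs_le_between in HC; lra.
  - exists (0 - C), (fun _ => 0), 0, C; repeat split; auto.
    intros x; specialize (HC x); apply Rabs_le_between in HC; lra.
  - exists r0; split; [|split].
    + intros p q [g [s [t [Hg ->]]]] [g' [s' [t' [Hg' ->]]]].
      exists (fun x => g x + g' x), (s + s'), (t + t'); split.
      * exact (HA _ _ Hg Hg').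
      * simpl; f_equal; [extensionality x|]; ring.
    + intros u p [g [s [t [Hg ->]]]].
      exists (fun x => u * g x), (u * s), (u * t); split.
      * exact (HS u _ Hg).
      * simpl; f_equal; [extensionality x|]; ring.
    + intros p c [g [s [t [Hg ->]]]]; simpl; intros Hc.
      (* Dividing by the absolute value of [t] reduces to [f0] or its negative, where the lower and
         upper bounds on [r0] apply. *)
      destruct (Rtotal_order t 0) as [Ht|[->|Ht]].
      * assert (H : / (- t) * s - / (- t) * c <= r0).
        { apply Hub; exists (fun x => / (- t) * g x), (/ (- t) * s), (/ (- t) * c).
          split; [exact (HS _ _ Hg)|split; [|reflexivity]].
          intros x.
          replace (/ - t * g x - f0 x) with (/ (- t) * (g x + t * f0 x)) by (field; lra).
          apply Rmult_le_compat_l; [|apply Hc].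
          left; apply Rinv_0_lt_compat; lra. }
        apply (Rmult_le_compat_l (- t)) in H; [|lra].
        replace (- t * (/ - t * s - / - t * c)) with (s - c) in H by (field; lra).
        lra.
      * assert (s <= c); [|lra].
        apply (HD _ c Hg); intros x; specialize (Hc x); simpl in *; lra.
      * assert (H : r0 <= / t * c - / t * s).
        { apply Hlub; intros r Hr.
          apply (Hcons (fun x => / t * g x) (/ t * s) (/ t * c) r (HS _ _ Hg)); auto.
          intros x; simpl.
          replace (/ t * g x + f0 x) with (/ t * (g x + t * f0 x)) by (field; lra).
          apply Rmult_le_compat_l; [|apply Hc].
          left; apply Rinv_0_lt_compat; lra. }
        apply (Rmult_le_compat_l t) in H; [|lra].
        replace (t * (/ t * c - / t * s)) with (c - s) in H by (field; lra).
        lra.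
Qed.

(** A finitely additive probability integral. The field [mean_le], used with negative scalars as
    well, encodes both positivity and normalization. *)
Record mean {X : Type} (F : (X -> R) -> R) : Prop := {
  mean_add : forall f g, bounded f -> bounded g -> F (fun x => f x + g x) = F f + F g;
  mean_scale : forall t f, bounded f -> F (fun x => t * f x) = t * F f;
  mean_le : forall f c, bounded f -> (forall x, f x <= c) -> F f <= c
}.

(** The last hypothesis says that the zero functional on [W] is dominated by the supremum. Zorn's
    lemma gives a maximal dominated graph extending it, and the one-step extension makes that graph
    total. *)
Theorem mean_vanishing_on_subspace {X : Type} (W : (X -> R) -> Prop) :
  W (fun _ => 0) ->
  (forall f g, W f -> W g -> W (fun x => f x + g x)) ->
  (forall t f, W f -> W (fun x => t * f x)) ->
  (forall f, W f -> bounded f) ->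
  (forall f c, W f -> (forall x, f x <= c) -> 0 <= c) ->
  exists F : (X -> R) -> R, mean F /\ forall f, W f -> F f = 0.
Proof.
  intros W0 WA WS WB WD.
  set (W' := fun p : (X -> R) * R => W (fst p) /\ snd p = 0).
  assert (GW : dominated_graph W').
  { split; [|split].
    - intros p q [Hp Ep] [Hq Eq]; split; simpl; [auto|lra].
    - intros t p [Hp Ep]; split; simpl; [auto|rewrite Ep; ring].
    - intros p c [Hp Ep] Hc; rewrite Ep; eauto. }
  (* The condition is put on the union with [W'], so that the empty chain also satisfies it. *)
  destruct (classical_sets.Zorn_bigcup
    (P := fun G : (X -> R) * R -> Prop => dominated_graph (fun p => G p \/ W' p)))
    as [A [GA Amax]].
  { intros Ch HCh tot.
    set (U := classical_sets.bigcup Ch (fun Y => Y)).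
    assert (HU : forall G, Ch G -> forall p, G p \/ W' p -> U p \/ W' p).
    { intros G HG p [Hp|Hp]; [left; now exists G|now right]. }
    assert (one : forall p, U p \/ W' p -> W' p \/ exists G, Ch G /\ G p).
    { intros p [[G HG Hp]|Hp]; [right; now exists G|now left]. }
    split; [|split].
    - intros p q Hp Hq.
      assert (two : (W' p /\ W' q) \/
        exists G, Ch G /\ (G p \/ W' p) /\ (G q \/ W' q)).
      { destruct (one p Hp) as [Hp'|[G [HG Hp']]];
        destruct (one q Hq) as [Hq'|[H [HH Hq']]]; auto.
        - right; exists H; auto.
        - right; exists G; auto.
        - right; destruct (tot G H HG HH) as [s|s].
          + exists H; split; auto.
          + exists G; split; auto. }
      destruct two as [[Hp' Hq']|[G [HG [Hp' Hq']]]].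
      + right; exact (proj1 GW _ _ Hp' Hq').
      + apply (HU G HG); exact (proj1 (HCh G HG) _ _ Hp' Hq').
    - intros t p Hp; destruct (one p Hp) as [Hp'|[G [HG Hp']]].
      + right; exact (proj1 (proj2 GW) _ _ Hp').
      + apply (HU G HG); apply (proj1 (proj2 (HCh G HG))); now left.
    - intros p c Hp; destruct (one p Hp) as [Hp'|[G [HG Hp']]].
      + exact (proj2 (proj2 GW) _ _ Hp').
      + apply (proj2 (proj2 (HCh G HG))); now left. }
  set (G := fun p => A p \/ W' p) in *.
  assert (G0 : G (fun _ => 0, 0)) by (right; split; auto).
  assert (tot : forall f, bounded f -> exists r, G (f, r)).
  { intros f Hf.
    destruct (dominated_graph_extend G f GA G0 Hf) as [r0 Hr0].
    set (G' := fun p => _) in Hr0.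
    (* If [(f, r0)] were missing from [G], the extension [G'] would be dominated and strictly larger
       than [A]. *)
    exists r0; apply NNPP; intros nG; apply (Amax G').
    - assert (sub : forall p, G p -> G' p).
      { intros [g s] Hp; exists g, s, 0; split; auto.
        f_equal; [extensionality x|]; ring. }
      split.
      + intros p Hp; apply sub; now left.
      + intros H; apply nG; left; apply H.
        exists (fun _ => 0), 0, 1; split; auto.
        f_equal; [extensionality x|]; ring.
    - apply (dominated_graph_ext G'); auto.
      intros p; split; [now left|intros [Hp|Hp]; auto].
      destruct p as [g s]; exists g, s, 0; split; [now right|].
      f_equal; [extensionality x|]; ring. }
  destruct GA as [HA [HS HD]].
  assert (uniq : forall f r s, G (f, r) -> G (f, s) -> r = s).
  { assert (le : forall f r s, G (f, r) -> G (f, s) -> r <= s).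
    { intros f r s Hr Hs.
      pose proof (HA _ _ Hr (HS (-1) _ Hs)) as H; simpl in H.
      assert (r + -1 * s <= 0); [|lra].
      apply (HD _ 0 H); intros x; simpl; lra. }
    intros f r s Hr Hs; apply Rle_antisym; eauto. }
  set (F := fun f => epsilon (inhabits 0) (fun r => G (f, r))).
  assert (FG : forall f, bounded f -> G (f, F f)).
  { intros f Hf; apply (epsilon_spec (inhabits 0) (fun r => G (f, r))); auto. }
  exists F; split; [split|].
  - intros f g Hf Hg.
    apply (uniq (fun x => f x + g x)).
    + apply FG, bounded_add; assumption.
    + exact (HA _ _ (FG _ Hf) (FG _ Hg)).
  - intros t f Hf.
    apply (uniq (fun x => t * f x)).
    + apply FG, bounded_scale; assumption.
    + exact (HS _ _ (FG _ Hf)).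
  - intros f c Hf Hc; exact (HD _ c (FG _ Hf) Hc).
  - intros f Hf; apply (uniq f); [apply FG; auto|right; now split].
Qed.

(** * Means and integration against a charge *)

Lemma indic_true {X : Type} (S : X -> Prop) x : S x -> indic S x = 1.
Proof. intros H; unfold indic; destruct excluded_middle_informative; tauto. Qed.

Lemma indic_false {X : Type} (S : X -> Prop) x : ~ S x -> indic S x = 0.
Proof. intros H; unfold indic; destruct excluded_middle_informative; tauto. Qed.

Lemma bounded_indic {X : Type} (S : X -> Prop) : bounded (indic S).
Proof.
  exists 1; intros x; unfold indic; destruct excluded_middle_informative;
    rewrite Rabs_pos_eq; lra.
Qed.

Lemma bounded_simple_val {X : Type} (l : list (R * (X -> Prop))) : bounded (simple_val l).
Proof.
  induction l as [|[c E] l IH]; simpl.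
  - apply bounded_const.
  - apply bounded_add; auto; apply bounded_scale, bounded_indic.
Qed.

Lemma mean_zero {X : Type} (F : (X -> R) -> R) : mean F -> F (fun _ => 0) = 0.
Proof.
  intros HF; pose proof (mean_scale F HF 0 (fun _ => 0) (bounded_const 0)) as H.
  rewrite Rmult_0_l in H; etransitivity; [|exact H].
  f_equal; extensionality x; ring.
Qed.

Lemma mean_const {X : Type} (F : (X -> R) -> R) (c : R) : mean F -> F (fun _ => c) = c.
Proof.
  intros HF.
  assert (H : forall r, F (fun _ => r) <= r).
  { intros r; apply (mean_le F HF); [apply bounded_const|intros; lra]. }
  apply Rle_antisym; auto.
  pose proof (mean_scale F HF (-1) (fun _ => c) (bounded_const c)) as E; simpl in E.
  pose proof (H (-1 * c)); lra.
Qed.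

Lemma mean_mono {X : Type} (F : (X -> R) -> R) (f g : X -> R) :
  mean F -> bounded f -> bounded g -> (forall x, f x <= g x) -> F f <= F g.
Proof.
  intros HF Hf Hg H.
  assert (E : F (fun x => f x + -1 * g x) <= 0).
  { apply (mean_le F HF); [apply bounded_add; auto using bounded_scale|].
    intros x; specialize (H x); lra. }
  rewrite (mean_add F HF), (mean_scale F HF) in E; auto using bounded_scale; lra.
Qed.

Lemma mean_comp {X Y : Type} (g : X -> Y) (F : (X -> R) -> R) :
  mean F -> mean (fun f : Y -> R => F (fun x => f (g x))).
Proof.
  intros HF; split.
  - intros f h Hf Hh; apply (mean_add F HF (fun x => f (g x)) (fun x => h (g x)));
      apply bounded_comp; assumption.
  - intros t f Hf; apply (mean_scale F HF t (fun x => f (g x))), bounded_comp, Hf.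
  - intros f c Hf H; apply (mean_le F HF); auto using bounded_comp.
Qed.

Lemma mean_simple_val (mu : charge_space) (F : (cI mu -> R) -> R) l :
  mean F -> (forall S, cA mu S -> F (indic S) = cmu mu S) ->
  (forall c S, In (c, S) l -> cA mu S) ->
  F (simple_val l) = simple_int mu l.
Proof.
  intros HF Hmu; induction l as [|[c E] l IH]; simpl; intros Hl.
  - now apply mean_zero.
  - rewrite <- IH, <- Hmu by eauto.
    rewrite <- (mean_scale F HF) by apply bounded_indic.
    apply (mean_add F HF);
      [apply bounded_scale, bounded_indic|apply bounded_simple_val].
Qed.

(** The layer-cake approximation of [f - t] from below, with steps of height [d] at the levels
    [t + d], ..., [t + k * d]. *)
Fixpoint staircase {X : Type} (f : X -> R) (d t : R) (k : nat) : list (R * (X -> Prop)) :=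
  match k with
  | O => nil
  | S k' => (d, fun x => t + d <= f x) :: staircase f d (t + d) k'
  end.

Lemma staircase_low {X : Type} (f : X -> R) d k t x :
  0 < d -> f x < t + d -> simple_val (staircase f d t k) x = 0.
Proof.
  intros Hd; revert t; induction k as [|k IH]; simpl; intros t H; auto.
  rewrite IH, indic_false by lra; ring.
Qed.

Lemma staircase_approx {X : Type} (f : X -> R) d k t x :
  0 < d -> t <= f x -> f x <= t + INR k * d ->
  f x - t - d <= simple_val (staircase f d t k) x <= f x - t.
Proof.
  intros Hd; revert t; induction k as [|k IH]; intros t H1 H2.
  - simpl in *; lra.
  - rewrite S_INR in H2; simpl staircase; simpl simple_val.
    destruct (Rle_dec (t + d) (f x)) as [H|H].
    + rewrite indic_true by exact H.
      specialize (IH (t + d)); lra.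
    + rewrite indic_false, staircase_low by lra; lra.
Qed.

Lemma staircase_sets {X : Type} (f : X -> R) d k t c (S : X -> Prop) :
  In (c, S) (staircase f d t k) -> exists u, S = fun x => u <= f x.
Proof.
  revert t; induction k as [|k IH]; simpl; intros t; [easy|].
  intros [E|E]; [|eauto].
  inversion E; eauto.
Qed.

(** Simple functions below [f] have integral at most [F f] by monotonicity, and staircases built on
    the level sets of [f] come within any [d] of it. *)
Lemma integral_mean (mu : charge_space) (F : (cI mu -> R) -> R) (f : cI mu -> R) :
  mean F -> (forall S, cA mu S -> F (indic S) = cmu mu S) ->
  bounded f -> (forall t, cA mu (fun i => t <= f i)) ->
  integral mu f = F f.
Proof.
  intros HF Hmu Hf Hlev; unfold integral.
  erewrite is_lub_Rbar_unique with (l := Finite (F f)); [reflexivity|split].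
  - intros r [l [Hl [Hle ->]]]; simpl.
    rewrite <- (mean_simple_val mu F) by auto.
    apply mean_mono; auto using bounded_simple_val.
  - intros b Hb.
    assert (Happ : forall d, 0 < d -> Rbar_le (F f - d) b).
    { intros d Hd; destruct Hf as [C HC].
      destruct (nfloor_ex (Rmax 0 (2 * C / d)) (Rmax_l _ _)) as [k [_ Hk]].
      assert (Hk' : 2 * C <= INR (S k) * d).
      { rewrite S_INR; apply (Rmult_le_reg_r (/ d)); [now apply Rinv_0_lt_compat|].
        replace ((INR k + 1) * d * / d) with (INR k + 1) by (field; lra).
        pose proof (Rmax_r 0 (2 * C / d)); unfold Rdiv in *; lra. }
      (* The staircase starts at [- C], and [S k] steps cover the whole range up to [C]. The
         constant term undoes the shift by [C]. *)
      set (l := (- C, fun _ => True) :: staircase f d (- C) (S k)).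
      assert (Hl : forall c T, In (c, T) l -> cA mu T).
      { intros c T [E|E].
        - inversion E; apply cA_full.
        - destruct (staircase_sets _ _ _ _ _ _ E) as [u ->]; apply Hlev. }
      assert (Hv : forall i, f i + - d <= simple_val l i <= f i).
      { intros i; specialize (HC i); apply Rabs_le_between in HC.
        pose proof (staircase_approx f d (S k) (- C) i Hd ltac:(lra) ltac:(lra)).
        unfold l; cbn [simple_val]; rewrite indic_true by exact I; lra. }
      apply Rbar_le_trans with (Finite (simple_int mu l)).
      - rewrite <- (mean_simple_val mu F l HF Hmu Hl); cbn [Rbar_le].
        assert (Bf : bounded f) by now exists C.
        replace (F f - d) with (F (fun i => f i + - d)).
        + apply mean_mono; auto using bounded_simple_val.
          apply (bounded_add f); auto using bounded_const.
          intros i; apply Hv.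
        + rewrite (mean_add F HF), (mean_const F) by auto using bounded_const; lra.
      - apply Hb; exists l; repeat split; auto; intros i; apply Hv. }
    destruct b as [b| |]; simpl; auto.
    + apply Rnot_lt_le; intros Hlt.
      specialize (Happ ((F f - b) / 2)); simpl in Happ; lra.
    + exact (Happ 1 Rlt_0_1).
Qed.

(** * Values of affine formulas: quantifiers, boundedness, free variables *)

(** Since [real] sends infinities to 0, boundedness is needed to exclude [p_infty]; [m_infty] is
    excluded by the value at [a]. *)
Lemma feval_sup_ge {L} (M : Lstruc L) s x phi a :
  bounded (fun s => feval M s phi) -> feval M (upd s x a) phi <= feval M s (fsup x phi).
Proof.
  intros [C HC]; simpl.
  destruct (Lub_Rbar_correct (fun r => exists a : M, r = feval M (upd s x a) phi)) as [ub lub].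
  destruct (Lub_Rbar _) as [l| |]; simpl.
  - apply (ub (feval M (upd s x a) phi)); eauto.
  - destruct (lub C); intros r [a' ->]; simpl.
    specialize (HC (upd s x a')); apply Rabs_le_between in HC; lra.
  - destruct (ub (feval M (upd s x a) phi)); eauto.
Qed.

Lemma feval_sup_le {L} (M : Lstruc L) s x phi c :
  (forall a, feval M (upd s x a) phi <= c) -> feval M s (fsup x phi) <= c.
Proof.
  intros H; simpl.
  destruct (Lub_Rbar_correct (fun r => exists a : M, r = feval M (upd s x a) phi)) as [ub lub].
  destruct (car_inhab L M) as [a].
  destruct (Lub_Rbar _) as [l| |]; simpl.
  - apply (lub c); intros r [a' ->]; simpl; auto.
  - destruct (lub c); intros r [a' ->]; simpl; auto.
  - destruct (ub (feval M (upd s x a) phi)); eauto.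
Qed.

Lemma feval_inf_le {L} (M : Lstruc L) s x phi a :
  bounded (fun s => feval M s phi) -> feval M s (finf x phi) <= feval M (upd s x a) phi.
Proof.
  intros [C HC]; simpl.
  destruct (Glb_Rbar_correct (fun r => exists a : M, r = feval M (upd s x a) phi)) as [lb glb].
  destruct (Glb_Rbar _) as [l| |]; simpl.
  - apply (lb (feval M (upd s x a) phi)); eauto.
  - destruct (lb (feval M (upd s x a) phi)); eauto.
  - destruct (glb (- C)); intros r [a' ->]; simpl.
    specialize (HC (upd s x a')); apply Rabs_le_between in HC; lra.
Qed.

Lemma feval_inf_ge {L} (M : Lstruc L) s x phi c :
  (forall a, c <= feval M (upd s x a) phi) -> c <= feval M s (finf x phi).
Proof.
  intros H; simpl.
  destruct (Glb_Rbar_correct (fun r => exists a : M, r = feval M (upd s x a) phi)) as [lb glb].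
  destruct (car_inhab L M) as [a].
  destruct (Glb_Rbar _) as [l| |]; simpl.
  - apply (glb c); intros r [a' ->]; simpl; auto.
  - destruct (lb (feval M (upd s x a) phi)); eauto.
  - destruct (glb c); intros r [a' ->]; simpl; auto.
Qed.

Lemma feval_bounded {L} (M : Lstruc L) (phi : formula L) :
  bounded (fun s => feval M s phi).
Proof.
  induction phi as [|t1 t2|P args|p IHp q IHq|r p IHp|x p IHp|x p IHp].
  - exact (bounded_const 1).
  - exists 1; intros s; simpl; rewrite Rabs_pos_eq; [apply dist_le1|apply dist_nonneg].
  - exists (rbound L P); intros s; apply rels_bound.
  - exact (bounded_add _ _ IHp IHq).
  - exact (bounded_scale r _ IHp).
  - destruct (car_inhab L M) as [a].
    pose proof IHp as [C HC]; exists C; intros s; apply Rabs_le_between; split.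
    + eapply Rle_trans; [|apply (feval_sup_ge M s x p a IHp)].
      now specialize (HC (upd s x a)); apply Rabs_le_between in HC.
    + apply feval_sup_le; intros b.
      now specialize (HC (upd s x b)); apply Rabs_le_between in HC.
  - destruct (car_inhab L M) as [a].
    pose proof IHp as [C HC]; exists C; intros s; apply Rabs_le_between; split.
    + apply feval_inf_ge; intros b.
      now specialize (HC (upd s x b)); apply Rabs_le_between in HC.
    + eapply Rle_trans; [apply (feval_inf_le M s x p a IHp)|].
      now specialize (HC (upd s x a)); apply Rabs_le_between in HC.
Qed.

Lemma teval_ext {L} (M : Lstruc L) (s s' : nat -> M) (t : term L) :
  (forall n, occurs n t -> s n = s' n) -> teval M s t = teval M s' t.
Proof.
  induction t as [n|f args IH]; simpl; intros H; [now apply H|].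
  f_equal; extensionality k; apply IH; eauto.
Qed.

Lemma feval_ext {L} (M : Lstruc L) (phi : formula L) : forall s s' : nat -> M,
  (forall n, free n phi -> s n = s' n) -> feval M s phi = feval M s' phi.
Proof.
  assert (Hupd : forall x (p : formula L) (s s' : nat -> M) a,
    (forall n, n <> x /\ free n p -> s n = s' n) ->
    forall n, free n p -> upd s x a n = upd s' x a n).
  { intros x p s s' a H n Hn; unfold upd; destruct (Nat.eqb_spec n x); auto. }
  induction phi as [|t1 t2|P args|p IHp q IHq|r p IHp|x p IHp|x p IHp];
    simpl; intros s s' H.
  - reflexivity.
  - f_equal; apply teval_ext; auto.
  - f_equal; extensionality k; apply teval_ext; eauto.
  - f_equal; auto.
  - f_equal; auto.
  - do 2 f_equal; extensionality r; apply propositional_extensionality.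
    split; intros [a ->]; exists a; [|symmetry]; apply IHp; now apply Hupd.
  - do 2 f_equal; extensionality r; apply propositional_extensionality.
    split; intros [a ->]; exists a; [|symmetry]; apply IHp; now apply Hupd.
Qed.

Lemma fin_list_union n (P : Fin.t n -> nat -> Prop) :
  (forall k, exists l, forall m, P k m -> In m l) ->
  exists l, forall k m, P k m -> In m l.
Proof.
  induction n as [|n IH]; intros H.
  - exists nil; intros k; exact (Fin.case0 (fun _ => _) k).
  - destruct (IH (fun k => P (Fin.FS k))) as [l Hl]; [auto|].
    destruct (H Fin.F1) as [l0 Hl0].
    exists (l0 ++ l); intros k m; revert m.
    apply (Fin.caseS' k); intros; apply in_or_app; eauto.
Qed.

Lemma occurs_finite {L} (t : term L) : exists l, forall n, occurs n t -> In n l.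
Proof.
  induction t as [m|f args IH]; simpl.
  - exists (m :: nil); intros n ->; now left.
  - destruct (fin_list_union _ _ IH) as [l Hl].
    exists l; intros n [k Hk]; eauto.
Qed.

Lemma free_finite {L} (phi : formula L) : exists l, forall n, free n phi -> In n l.
Proof.
  induction phi as [|t1 t2|P args|p [l1 H1] q [l2 H2]|r p IHp|x p [l H]|x p [l H]]; simpl.
  - exists nil; tauto.
  - destruct (occurs_finite t1) as [l1 H1], (occurs_finite t2) as [l2 H2].
    exists (l1 ++ l2); intros n [Hn|Hn]; apply in_or_app; auto.
  - destruct (fin_list_union _ (fun k n => occurs n (args k))) as [l Hl].
    + intros k; apply occurs_finite.
    + exists l; intros n [k Hk]; eauto.
  - exists (l1 ++ l2); intros n [Hn|Hn]; apply in_or_app; auto.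
  - exact IHp.
  - exists l; intros n [_ Hn]; auto.
  - exists l; intros n [_ Hn]; auto.
Qed.

(** * Quantifier-free formulas and renaming of variables *)

Fixpoint quantifier_free {L} (phi : formula L) : Prop :=
  match phi with
  | fone | fdist _ _ | frel _ _ => True
  | fadd p q => quantifier_free p /\ quantifier_free q
  | fscale _ p => quantifier_free p
  | fsup _ _ | finf _ _ => False
  end.

Fixpoint trename {L} (rho : nat -> nat) (t : term L) : term L :=
  match t with
  | tvar n => tvar (rho n)
  | tapp f args => tapp f (fun k => trename rho (args k))
  end.

(* Meaningful on quantifier-free formulas only: bound variables are left alone. *)
Fixpoint frename {L} (rho : nat -> nat) (phi : formula L) : formula L :=
  match phi with
  | fone => fone
  | fdist t1 t2 => fdist (trename rho t1) (trename rho t2)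
  | frel P args => frel P (fun k => trename rho (args k))
  | fadd p q => fadd (frename rho p) (frename rho q)
  | fscale r p => fscale r (frename rho p)
  | fsup x p => fsup x p
  | finf x p => finf x p
  end.

Lemma teval_rename {L} (M : Lstruc L) rho (s : nat -> M) (t : term L) :
  teval M s (trename rho t) = teval M (fun n => s (rho n)) t.
Proof.
  induction t as [n|f args IH]; simpl; auto.
  f_equal; extensionality k; apply IH.
Qed.

Lemma feval_rename {L} (M : Lstruc L) rho (s : nat -> M) (phi : formula L) :
  quantifier_free phi -> feval M s (frename rho phi) = feval M (fun n => s (rho n)) phi.
Proof.
  induction phi; simpl; intros H; rewrite ?teval_rename; try tauto.
  - f_equal; extensionality k; apply teval_rename.
  - destruct H; f_equal; auto.
  - f_equal; auto.
Qed.

Lemma frename_quantifier_free {L} rho (phi : formula L) :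
  quantifier_free phi -> quantifier_free (frename rho phi).
Proof. induction phi; simpl; tauto. Qed.

Lemma occurs_rename {L} rho n (t : term L) :
  occurs n (trename rho t) -> exists m, occurs m t /\ n = rho m.
Proof.
  induction t as [m|f args IH]; simpl; [eauto|].
  intros [k Hk]; destruct (IH k Hk) as [m [Hm ->]]; eauto.
Qed.

Lemma free_rename {L} rho n (phi : formula L) :
  quantifier_free phi -> free n (frename rho phi) -> exists m, free m phi /\ n = rho m.
Proof.
  induction phi as [|t1 t2|P args|p IHp q IHq|r p IHp|x p IHp|x p IHp];
    simpl; intros Hq; try tauto.
  - intros [H|H]; destruct (occurs_rename _ _ _ H) as [m [Hm ->]]; eauto.
  - intros [k H]; destruct (occurs_rename _ _ _ H) as [m [Hm ->]]; eauto.
  - intros [H|H]; [destruct (IHp (proj1 Hq) H) as [m [Hm ->]]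
                  |destruct (IHq (proj2 Hq) H) as [m [Hm ->]]]; eauto.
Qed.

(** Turns the arguments of a symbol into an assignment of the variables, which are indexed by
    [nat]. *)
Lemma fin_extend n {A : Type} (s : Fin.t n -> A) (d : A) :
  exists e : nat -> A, forall k, e (proj1_sig (Fin.to_nat k)) = s k.
Proof.
  exists (fun m => match Compare_dec.lt_dec m n with
                   | left h => s (Fin.of_nat_lt h)
                   | right _ => d
                   end).
  intros k; destruct Compare_dec.lt_dec as [h|h].
  - f_equal; rewrite <- (Fin.of_nat_to_nat_inv k); apply Fin.of_nat_ext.
  - destruct h; exact (proj2_sig (Fin.to_nat k)).
Qed.

(** * Formal trees and their valuations *)

Section Trees.

Context {L : Lang} (St : bool -> Lstruc L).

(* Big enough to index the points of each structure and any family whose size is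
   at most the weight of one of them. *)
Definition index : Type := ({b : bool & St b -> Prop} + nat)%type.

(** With sequences, prepending an entry injects [index * arity] into [arity], so that a family of
    [arity]-indexed families can be merged into one. *)
Definition arity : Type := nat -> index.

(* A node tagged [b] is constrained on side [b] only, so [f (negb b)] is junk. *)
Inductive tree : Type :=
| leaf : tree
| node (b : bool) (f : forall c, (arity -> St c) -> St c) (a : arity -> tree).

Inductive inside (s : tree) : tree -> Prop :=
| inside_refl : inside s s
| inside_arg b f a l : inside s (a l) -> inside s (node b f a).

Definition valuation (b : bool) : Type :=
  {v : tree -> St b | forall f a, v (node b f a) = f b (fun l => v (a l))}.

Definition val {b} (v : valuation b) : tree -> St b := proj1_sig v.

Lemma inside_trans s t u : inside s t -> inside t u -> inside s u.
Proof. intros Hs Ht; induction Ht; [exact Hs|exact (inside_arg _ _ _ _ _ IHHt)]. Qed.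

(** Otherwise [a l] would in turn lie inside one of its own arguments, which structural induction
    excludes. *)
Lemma inside_arg_irrefl b f a l : ~ inside (node b f a) (a l).
Proof.
  enough (H : forall t b f a l, t = node b f a -> ~ inside t (a l)) by eauto.
  clear; intros t; induction t as [|b0 f0 a0 IH]; intros b f a l E H; [easy|].
  inversion E; subst b0 f0 a0; clear E.
  remember (a l) as u eqn:Eu; destruct H as [|b' f' a' l' H].
  - apply (IH l b f a l (eq_sym Eu)); rewrite <- Eu; constructor.
  - apply (IH l b' f' a' l' (eq_sym Eu)).
    apply inside_trans with (2 := H); rewrite <- Eu.
    apply (inside_arg _ b f a l); rewrite <- Eu; constructor.
Qed.

Lemma inside_antisym s t : inside s t -> inside t s -> s = t.
Proof.
  intros H H'; destruct H as [|b f a l H]; [reflexivity|].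
  destruct (inside_arg_irrefl b f a l (inside_trans _ _ _ H' H)).
Qed.

Lemma exists_outermost {A : Type} (sigma : A -> tree) (l : list A) :
  l <> nil ->
  exists j, In j l /\ forall i, In i l -> inside (sigma j) (sigma i) -> sigma i = sigma j.
Proof.
  induction l as [|x l IH]; intros Hl; [easy|].
  destruct l as [|y l].
  - exists x; split; [now left|intros i [->|[]]; auto].
  - destruct IH as [j [Hj Hmax]]; [easy|].
    destruct (excluded_middle_informative (inside (sigma j) (sigma x))) as [H|H].
    + exists x; split; [now left|]; intros i [->|Hi] Hx; [reflexivity|].
      pose proof (Hmax i Hi (inside_trans _ _ _ H Hx)) as E.
      rewrite E in Hx |- *; now apply inside_antisym.
    + exists j; split; [now right|]; intros i [->|Hi] Hx; [tauto|auto].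
Qed.

(** Valuations are free on [leaf] and on the nodes of the other tag: [d] chooses these values, and
    recursion computes those at nodes tagged [b]. *)
Fixpoint fill (b : bool) (d : tree -> St b) (t : tree) : St b :=
  match t with
  | leaf => d leaf
  | node b' f a => if Bool.eqb b' b then f b (fun l => fill b d (a l)) else d t
  end.

Definition filled (b : bool) (d : tree -> St b) : valuation b.
Proof.
  exists (fill b d); intros f a; simpl; now rewrite Bool.eqb_reflx.
Defined.

Lemma filled_free b d t : (forall f a, t <> node b f a) -> val (filled b d) t = d t.
Proof.
  destruct t as [|b' f a]; intros H; [reflexivity|]; simpl.
  destruct (Bool.eqb_spec b' b) as [->|]; [now destruct (H f a)|reflexivity].
Qed.

Lemma valuation_inhab b : inhabited (valuation b).
Proof.
  destruct (car_inhab L (St b)) as [m]; constructor; exact (filled b (fun _ => m)).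
Qed.

(** Refill from the values of [v] with the one at [s] reset to [m]; only trees containing [s] can
    notice. *)
Lemma valuation_change b (v : valuation b) s m :
  (forall f a, s <> node b f a) ->
  exists v' : valuation b, val v' s = m /\ forall t, ~ inside s t -> val v' t = val v t.
Proof.
  intros Hs.
  set (d := fun t => if excluded_middle_informative (t = s) then m else val v t).
  exists (filled b d); split.
  - rewrite filled_free by exact Hs; unfold d.
    destruct excluded_middle_informative; tauto.
  - assert (Hd : forall t, ~ inside s t -> d t = val v t).
    { intros t Ht; unfold d; destruct excluded_middle_informative as [->|]; auto.
      destruct Ht; constructor. }
    induction t as [|b' f a IH]; intros Ht; [now apply Hd|].
    change (fill b d (node b' f a) = val v (node b' f a)); simpl.
    destruct (Bool.eqb_spec b' b) as [->|]; [|now apply Hd].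
    unfold val; rewrite (proj2_sig v).
    f_equal; extensionality l; apply IH; intros H; exact (Ht (inside_arg _ _ _ _ l H)).
Qed.

(** * Comparing the extreme values of a formula on the two sides *)

Definition eval {b} (sigma : nat -> tree) (phi : formula L) (v : valuation b) : R :=
  feval (St b) (fun n => val v (sigma n)) phi.

Lemma eval_bounded b sigma phi : bounded (@eval b sigma phi).
Proof.
  exact (bounded_comp (fun v : valuation b => fun n => val v (sigma n)) _
           (feval_bounded (St b) phi)).
Qed.

(** As [sigma j] lies inside no other listed tree, its value can be reset without disturbing the
    other variables. *)
Lemma eval_upd b sigma phi (l : list nat) j (v : valuation b) m :
  (forall k, free k phi -> In k l) ->
  (forall k, In k l -> inside (sigma j) (sigma k) -> k = j) ->
  (forall f a, sigma j <> node b f a) ->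
  exists v' : valuation b,
    feval (St b) (upd (fun n => val v (sigma n)) j m) phi = eval sigma phi v'.
Proof.
  intros Hl Hj Hs; destruct (valuation_change b v (sigma j) m Hs) as [v' [E H]].
  exists v'; apply feval_ext; intros k Hk; unfold upd.
  destruct (Nat.eqb_spec k j) as [->|n]; [now rewrite E|].
  symmetry; apply H; intros Hin; auto.
Qed.

(* The outermost tree is unconstrained on one of the two sides; there, quantifying
   its variable away does not change the extreme value, while on the other side the
   quantifier can only help. *)
Lemma sup_ge_inf sigma :
  aff_equiv (St true) (St false) ->
  forall (l : list nat) phi,
    (forall k, free k phi -> In k l) ->
    (forall i j, In i l -> In j l -> sigma i = sigma j -> i = j) ->
    forall c d,
      (forall v : valuation true, eval sigma phi v <= c) ->
      (forall w : valuation false, d <= eval sigma phi w) -> d <= c.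
Proof.
  intros equiv l.
  induction l as [l IH] using (induction_ltof1 _ (@length nat)); unfold ltof in IH.
  intros phi Hfree Hinj c d Hc Hd.
  destruct (excluded_middle_informative (l = nil)) as [->|Hl].
  (* With no variable left the formula is a sentence, and the equivalence of the two structures
     applies. *)
  { destruct (valuation_inhab true) as [v], (valuation_inhab false) as [w].
    specialize (Hc v); specialize (Hd w); unfold eval in Hc, Hd.
    rewrite (equiv phi Hfree _ (fun n => val w (sigma n))) in Hc; lra. }
  destruct (exists_outermost sigma l Hl) as [j [Hjl Hout]].
  assert (Hj : forall k, In k l -> inside (sigma j) (sigma k) -> k = j) by auto.
  pose proof (remove_length_lt Nat.eq_dec l j Hjl) as Hlen.
  assert (Hinj' : forall i k, In i (remove Nat.eq_dec j l) -> In k (remove Nat.eq_dec j l) ->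
                    sigma i = sigma k -> i = k).
  { intros i k Hi Hk; apply Hinj; eapply in_remove; eauto. }
  assert (Hfree' : forall k, k <> j /\ free k phi -> In k (remove Nat.eq_dec j l)).
  { intros k [n Hk]; apply in_in_remove; auto. }
  (* A node tagged [true] is free on the [false] side, hence [finf]; a [leaf] or a node tagged
     [false] is free on the [true] side, hence [fsup]. *)
  destruct (excluded_middle_informative (exists f a, sigma j = node true f a)) as [Hs|Hs].
  - apply (IH _ Hlen (finf j phi)); auto.
    + intros v; eapply Rle_trans; [|apply (Hc v)].
      unfold eval; eapply Rle_trans;
        [apply (feval_inf_le _ _ j phi (val v (sigma j)) (feval_bounded _ _))|].
      right; apply feval_ext; intros k _; unfold upd.
      destruct (Nat.eqb_spec k j) as [->|]; reflexivity.
    + intros w; apply feval_inf_ge; intros m.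
      destruct (eval_upd false sigma phi l j w m Hfree Hj) as [w' ->]; auto.
      destruct Hs as [f [a ->]]; intros f' a' E; discriminate E.
  - apply (IH _ Hlen (fsup j phi)); auto.
    + intros v; apply feval_sup_le; intros m.
      destruct (eval_upd true sigma phi l j v m Hfree Hj) as [v' ->]; auto.
      intros f a E; apply Hs; eauto.
    + intros w; eapply Rle_trans; [apply (Hd w)|].
      unfold eval; eapply Rle_trans;
        [|apply (feval_sup_ge _ _ j phi (val w (sigma j)) (feval_bounded _ _))].
      right; apply feval_ext; intros k _; unfold upd.
      destruct (Nat.eqb_spec k j) as [->|]; reflexivity.
Qed.

Lemma sup_ge_inf_quantifier_free sigma phi c d :
  aff_equiv (St true) (St false) -> quantifier_free phi ->
  (forall v : valuation true, eval sigma phi v <= c) ->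
  (forall w : valuation false, d <= eval sigma phi w) -> d <= c.
Proof.
  intros equiv Hq Hc Hd.
  (* Variables denoting the same tree are identified first. *)
  set (rho := fun n => epsilon (inhabits O) (fun m => sigma m = sigma n)).
  assert (Hrho : forall n, sigma (rho n) = sigma n).
  { intros n; apply (epsilon_spec (inhabits O) (fun m => sigma m = sigma n)); eauto. }
  assert (E : forall b (v : valuation b), eval sigma (frename rho phi) v = eval sigma phi v).
  { intros b v; unfold eval; rewrite feval_rename by exact Hq.
    f_equal; extensionality n; now rewrite Hrho. }
  destruct (free_finite phi) as [l Hl].
  apply (sup_ge_inf sigma equiv (map rho l) (frename rho phi)).
  - intros k Hk; destruct (free_rename _ _ _ Hq Hk) as [m [Hm ->]].
    apply in_map; auto.
  - intros i j Hi Hj; apply in_map_iff in Hi, Hj.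
    destruct Hi as [i' [<- _]], Hj as [j' [<- _]]; rewrite !Hrho; intros H.
    unfold rho; now rewrite H.
  - intros v; now rewrite E.
  - intros w; now rewrite E.
Qed.

(** * A mean on pairs of valuations whose marginals agree on quantifier-free formulas *)

Definition defect (sigma : nat -> tree) (phi : formula L) (x : forall b, valuation b) : R :=
  eval sigma phi (x true) + -1 * eval sigma phi (x false).

Lemma defect_bounded sigma phi : bounded (defect sigma phi).
Proof.
  apply bounded_add; [|apply bounded_scale];
    exact (bounded_comp (fun x : forall b, valuation b => x _) _ (eval_bounded _ sigma phi)).
Qed.

(** Let [C] be the supremum over the [true] side. The bound on the defect puts every value on the
    [false] side above [C - c], so the comparison of extreme values yields [C - c <= C]. *)
Lemma defect_dominated sigma phi c :
  aff_equiv (St true) (St false) -> quantifier_free phi ->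
  (forall x, defect sigma phi x <= c) -> 0 <= c.
Proof.
  intros equiv Hq H.
  destruct (valuation_inhab true) as [v0], (valuation_inhab false) as [w0].
  assert (H' : forall (v : valuation true) (w : valuation false),
    eval sigma phi v - c <= eval sigma phi w).
  { intros v w.
    specialize (H (fun b => if b return valuation b then v else w)).
    unfold defect in H; lra. }
  destruct (completeness (fun r => exists v : valuation true, r = eval sigma phi v))
    as [C [ub lub]].
  - exists (eval sigma phi w0 + c); intros r [v ->]; specialize (H' v w0); lra.
  - now exists (eval sigma phi v0), v0.
  - assert (C - c <= C); [|lra].
    apply (sup_ge_inf_quantifier_free sigma phi C (C - c) equiv Hq).
    + intros v; apply ub; eauto.
    + intros w; assert (C <= eval sigma phi w + c); [|lra].
      apply lub; intros r [v ->]; specialize (H' v w); lra.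
Qed.

Lemma joint_mean :
  aff_equiv (St true) (St false) ->
  exists F : ((forall b, valuation b) -> R) -> R,
    mean F /\ forall sigma phi, quantifier_free phi -> F (defect sigma phi) = 0.
Proof.
  intros equiv.
  destruct (mean_vanishing_on_subspace (fun f => exists sigma phi,
    quantifier_free phi /\ f = defect sigma phi)) as [F [HF HW]].
  - exists (fun _ => leaf), (fscale 0 fone); split; [exact I|].
    extensionality x; unfold defect, eval; simpl; ring.
  - intros f g [s [p [Hp ->]]] [s' [p' [Hp' ->]]].
    (* Even variables carry the first formula and odd ones the second, so the sum of two defects is
       again a defect. *)
    exists (fun n => if Nat.even n then s (Nat.div2 n) else s' (Nat.div2 n)),
      (fadd (frename (fun n => 2 * n)%nat p) (frename (fun n => S (2 * n)) p')).
    split; [split; now apply frename_quantifier_free|].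
    assert (E : forall n, Nat.even (2 * n) = true).
    { intros n; apply Nat.even_spec; now exists n. }
    extensionality x; unfold defect, eval; cbn [feval]; rewrite !feval_rename by assumption.
    assert (E1 : forall b (v : valuation b), (fun n => val v
      (if Nat.even (2 * n) then s (Nat.div2 (2 * n)) else s' (Nat.div2 (2 * n))))
      = fun n => val v (s n)).
    { intros b v; extensionality n; now rewrite E, Nat.div2_double. }
    assert (E2 : forall b (v : valuation b), (fun n => val v
      (if Nat.even (S (2 * n)) then s (Nat.div2 (S (2 * n))) else s' (Nat.div2 (S (2 * n)))))
      = fun n => val v (s' n)).
    { intros b v; extensionality n.
      now rewrite Nat.even_succ, <- Nat.negb_even, E, Nat.div2_succ_double. }
    rewrite !E1, !E2; ring.
  - intros t f [s [p [Hp ->]]]; exists s, (fscale t p); split; [exact Hp|].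
    extensionality x; unfold defect, eval; simpl; ring.
  - intros f [s [p [_ ->]]]; apply defect_bounded.
  - intros f c [s [p [Hp ->]]]; now apply defect_dominated.
  - exists F; split; eauto.
Qed.

(** * The algebra of sets determined by few coordinates, and its measurable maps *)

Definition determined {b} (P : valuation b -> Prop) : Prop :=
  exists a : arity -> tree, forall v v',
    (forall l, val v (a l) = val v' (a l)) -> P v -> P v'.

(** The head of a sequence selects [y] through its index, and the tail selects the position in
    [alpha y]; heads that index nothing get [leaf]. *)
Lemma arity_cover {Y : Type} (g : Y -> index) (alpha : Y -> arity -> tree) :
  (forall y y', g y = g y' -> y = y') ->
  exists a : arity -> tree, forall y l, exists l', a l' = alpha y l.
Proof.
  intros inj.
  exists (fun l => match excluded_middle_informative (exists y, g y = l O) with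
    | left h => alpha (proj1_sig (constructive_indefinite_description _ h)) (fun n => l (S n))
    | right _ => leaf
    end).
  intros y l; exists (fun n => match n with O => g y | S n => l n end).
  destruct excluded_middle_informative as [h|h]; [|destruct h; eauto].
  destruct constructive_indefinite_description as [y' Hy']; simpl in *.
  now rewrite (inj _ _ Hy').
Qed.

Lemma determined_common {b} {Y : Type} (g : Y -> index) (P : Y -> valuation b -> Prop) :
  (forall y y', g y = g y' -> y = y') -> (forall y, determined (P y)) ->
  exists a : arity -> tree, forall v v',
    (forall l, val v (a l) = val v' (a l)) -> forall y, P y v -> P y v'.
Proof.
  intros inj H.
  destruct (choice _ H) as [alpha Halpha].
  destruct (arity_cover g alpha inj) as [a Ha].
  exists a; intros v v' E y; apply Halpha; intros l.
  destruct (Ha y l) as [l' <-]; auto.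
Qed.

Lemma determined_full b : determined (fun _ : valuation b => True).
Proof. now exists (fun _ => leaf). Qed.

Lemma determined_compl b (P : valuation b -> Prop) :
  determined P -> determined (fun v => ~ P v).
Proof.
  intros [a Ha]; exists a; intros v v' E H H'; apply H, (Ha v' v); auto.
Qed.

Lemma determined_union b (P P' : valuation b -> Prop) :
  determined P -> determined P' -> determined (fun v => P v \/ P' v).
Proof.
  intros H H'.
  destruct (determined_common (fun y : bool => inr (if y then 0%nat else 1%nat))
    (fun y : bool => if y then P else P')) as [a Ha].
  - intros [|] [|] E; congruence.
  - intros [|]; assumption.
  - exists a; intros v v' E [Hv|Hv].
    + left; exact (Ha v v' E true Hv).
    + right; exact (Ha v v' E false Hv).
Qed.

Lemma determined_coords b (sigma : nat -> tree) (B : (nat -> St b) -> Prop) :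
  determined (fun v : valuation b => B (fun n => val v (sigma n))).
Proof.
  destruct (arity_cover (fun n => inr n) (fun n _ => sigma n)) as [a Ha].
  - intros n n' E; congruence.
  - exists a; intros v v' E.
    replace (fun n => val v' (sigma n)) with (fun n => val v (sigma n)); auto.
    extensionality n; destruct (Ha n (fun _ => inr O)) as [l <-]; auto.
Qed.

Definition valuation_charge b (F : (valuation b -> R) -> R) (HF : mean F) : charge_space.
Proof.
  refine {| cI := valuation b; cA := determined; cmu := fun P => F (indic P) |}.
  - apply determined_full.
  - apply determined_compl.
  - apply determined_union.
  - intros P _; rewrite <- (mean_zero F HF).
    apply (mean_mono F _ _ HF); [apply bounded_const|apply bounded_indic|].
    intros v; unfold indic; destruct excluded_middle_informative; lra.
  - rewrite <- (mean_const F 1 HF); f_equal; extensionality v; now apply indic_true.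
  - intros P P' _ _ H; rewrite <- (mean_add F HF) by apply bounded_indic.
    f_equal; extensionality v; unfold indic.
    repeat destruct excluded_middle_informative; try tauto; try lra.
    destruct (H v); assumption.
Defined.

Lemma index_inl_inj b (U U' : St b -> Prop) :
  @inl _ nat (existT (fun b => St b -> Prop) b U) = inl (existT _ b U') -> U = U'.
Proof.
  intros E; injection E; intros E'.
  exact (Eqdep_dec.inj_pair2_eq_dec _ Bool.bool_dec _ _ _ _ E').
Qed.

(** All open sets together form a base, so a family of size at most the weight embeds into [index];
    its members are then determined by common coordinates, and so is their intersection. *)
Lemma valuation_charge_meanable b F HF : meanable (St b) (valuation_charge b F HF).
Proof.
  right; intros K G HK HG.
  destruct (HK (mopen (St b))) as [g [inj _]].
  { split; [auto|]; intros U HU x Hx; exists U; auto. }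
  destruct (determined_common (b := b) (fun k => match g k with
      | inl U => inl (existT (fun b => St b -> Prop) b U)
      | inr n => inr n
      end) G) as [a Ha]; [|exact HG|].
  - intros k k' E; apply inj.
    destruct (g k), (g k'); try discriminate E.
    + f_equal; exact (index_inl_inj b _ _ E).
    + congruence.
  - exists a; intros v v' E H k; eauto.
Qed.

Lemma coord_measurable b F HF s :
  cmeas (St b) (valuation_charge b F HF) (fun v : valuation b => val v s).
Proof.
  intros B _; exact (determined_coords b (fun _ => s) (fun e => B (e O))).
Qed.

(** The fibres of [x] are determined, and there are few enough of them to share one family [a] of
    coordinates. Hence [x] is a function [g] of these coordinates, and a node applying [g] to [a]
    represents it. *)
Lemma measurable_coord b F HF (x : valuation b -> St b) :
  cmeas (St b) (valuation_charge b F HF) x -> exists s, forall v, x v = val v s.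
Proof.
  intros Hx.
  (* The double negation presents a point as the complement of an open set. *)
  assert (Hpt : forall m, determined (fun v => ~ x v <> m)).
  { intros m; apply (Hx (fun y => ~ y <> m)); intros Si [_ [Hc _]] Ho.
    apply Hc, Ho; intros y Hy; exists (Defs.dist (St b) y m); split.
    - destruct (dist_nonneg L (St b) y m) as [|E]; auto.
      destruct Hy; now apply dist_sep.
    - intros z Hz ->; lra. }
  (* Points are indexed by their singletons. *)
  destruct (determined_common (b := b)
    (fun m : St b => inl (existT (fun b => St b -> Prop) b (fun y => y = m)))
    (fun m v => ~ x v <> m)) as [a Ha]; [|exact Hpt|].
  { intros m m' E; apply index_inl_inj in E.
    change ((fun y => y = m') m); now rewrite <- E. }
  set (g := fun z : arity -> St b => epsilon (car_inhab L (St b))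
    (fun y => exists v, (fun l => val v (a l)) = z /\ y = x v)).
  assert (Hg : forall v, g (fun l => val v (a l)) = x v).
  { intros v.
    destruct (epsilon_spec (car_inhab L (St b))
      (fun y => exists v', (fun l => val v' (a l)) = (fun l => val v (a l)) /\ y = x v'))
      as [v' [E Ev']]; [eauto|].
    change (g (fun l => val v (a l)) = x v') in Ev'; rewrite Ev'; symmetry.
    apply NNPP; apply (Ha v' v (fun l => equal_f E l)); tauto. }
  (* A node needs an operation on each side; the one on the other side is arbitrary. *)
  assert (Hf : exists f : forall c, (arity -> St c) -> St c, f b = g).
  { clear - g; clearbody g.
    pose (d := fun (c : bool) (_ : arity -> St c) => epsilon (car_inhab L (St c)) (fun _ => True)).
    destruct b; [exists (fun c : bool => if c return (arity -> St c) -> St c then g else d false)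
                |exists (fun c : bool => if c return (arity -> St c) -> St c then d true else g)]; reflexivity. }
  destruct Hf as [f Hf]; exists (node b f a); intros v.
  unfold val; rewrite (proj2_sig v), Hf; symmetry; apply Hg.
Qed.

(** * The isomorphism of the two powers *)

Lemma integral_eval b F HF sigma phi :
  integral (valuation_charge b F HF) (eval sigma phi) = F (eval sigma phi).
Proof.
  apply (integral_mean (valuation_charge b F HF) F); auto.
  - apply eval_bounded.
  - intros t; exact (determined_coords b sigma (fun e => t <= feval (St b) e phi)).
Qed.

Theorem exists_charges_pow_iso :
  aff_equiv (St true) (St false) ->
  exists mu nu : charge_space,
    meanable (St true) mu /\ meanable (St false) nu /\
    pow_iso (St true) mu (St false) nu.
Proof.
  intros equiv; destruct (joint_mean equiv) as [F [HF Hdef]].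
  (* The two charges are the marginals of the joint mean. *)
  set (HFb := fun b => mean_comp (fun x : forall b, valuation b => x b) F HF).
  set (mu := fun b => valuation_charge b _ (HFb b)).
  assert (transfer : forall sigma phi, quantifier_free phi ->
    integral (mu false) (eval sigma phi) = integral (mu true) (eval sigma phi)).
  { intros sigma phi Hq; unfold mu; rewrite !integral_eval.
    assert (B : forall b, bounded (fun x : forall b, valuation b => eval sigma phi (x b))).
    { intros b; exact (bounded_comp (fun x : forall b, valuation b => x b) _
                         (eval_bounded b sigma phi)). }
    specialize (Hdef sigma phi Hq); unfold defect in Hdef.
    rewrite (mean_add F HF), (mean_scale F HF) in Hdef by auto using bounded_scale; lra. }
  exists (mu true), (mu false).
  split; [apply valuation_charge_meanable|split; [apply valuation_charge_meanable|]].
  set (rep := fun x : valuation true -> St true =>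
    epsilon (inhabits leaf) (fun s => x = fun v => val v s)).
  assert (Hrep : forall x, cmeas (St true) (mu true) x -> forall v, val v (rep x) = x v).
  { intros x Hx; apply (equal_f (eq_sym (epsilon_spec (inhabits leaf)
      (fun s => x = fun v => val v s) ltac:(
        destruct (measurable_coord true _ _ x Hx) as [s Hs];
        exists s; now extensionality v)))). }
  assert (Htriv : forall s,
    integral (mu true) (fun v => Defs.dist (St true) (val v s) (val v s)) = 0).
  { intros s.
    transitivity (integral (mu true) (eval (fun _ => leaf) (fscale 0 fone))).
    - f_equal; extensionality v; rewrite Defs.dist_refl; unfold eval; simpl; ring.
    - unfold mu; rewrite integral_eval; etransitivity; [|exact (mean_zero F HF)].
      f_equal; extensionality x; unfold eval; simpl; ring. }
  assert (Hdist : forall s t,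
    integral (mu false) (fun w => Defs.dist (St false) (val w s) (val w t))
    = integral (mu true) (fun v => Defs.dist (St true) (val v s) (val v t))).
  { intros s t; exact (transfer (fun n => match n with O => s | _ => t end)
                         (fdist (tvar 0) (tvar 1)) I). }
  exists (fun x w => val w (rep x)); split; [|split; [|split; [|split]]].
  - intros x _; apply coord_measurable.
  - intros x y Hx Hy; rewrite Hdist; f_equal; extensionality v.
    now rewrite (Hrep x Hx), (Hrep y Hy).
  - intros y Hy; destruct (measurable_coord false _ _ y Hy) as [s Hs].
    exists (fun v => val v s); split; [apply coord_measurable|].
    (* The tree [rep x] may differ from [s], but both have the same values on the [true] side, so
       their distance integrates to 0 there and hence on the [false] side. *)
    set (x := fun v : valuation true => val v s).
    replace y with (fun w : valuation false => val w s) by (extensionality w; auto).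
    rewrite Hdist.
    rewrite <- (Htriv s); f_equal; extensionality v.
    now rewrite (Hrep x (coord_measurable true _ _ s)).
  - intros f x Hx.
    destruct (fin_extend _ (fun k => rep (x k)) leaf) as [e He].
    set (y := fun v : valuation true => funs (St true) f (fun k => x k v)).
    (* Variable 0 stands for the image under [f], the later ones for its arguments; [phi] measures
       the failure of commutation. *)
    set (sigma := fun n => match n with O => rep y | S n => e n end).
    set (phi := fdist (tvar 0) (tapp f (fun k => tvar (S (proj1_sig (Fin.to_nat k)))))).
    assert (Ey : y = fun v =>
      funs (St true) f (fun k => val v (e (proj1_sig (Fin.to_nat k))))).
    { extensionality v; unfold y; f_equal; extensionality k.
      now rewrite He, (Hrep (x k) (Hx k)). }
    assert (Hy : cmeas (St true) (mu true) y).
    { intros B _; rewrite Ey.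
      exact (determined_coords true e (fun z =>
        B (funs (St true) f (fun k => z (proj1_sig (Fin.to_nat k)))))). }
    transitivity (integral (mu false) (eval sigma phi)).
    { f_equal; extensionality w; unfold eval, phi; simpl; do 2 f_equal.
      extensionality k; now rewrite He. }
    rewrite transfer by exact I.
    rewrite <- (Htriv (rep y)); f_equal; extensionality v.
    unfold eval, phi; simpl; f_equal.
    rewrite (Hrep y Hy).
    now rewrite Ey.
  - intros P x Hx.
    destruct (fin_extend _ (fun k => rep (x k)) leaf) as [e He].
    set (phi := frel P (fun k => tvar (proj1_sig (Fin.to_nat k)))).
    transitivity (integral (mu false) (eval e phi)).
    { f_equal; extensionality w; unfold eval, phi; simpl; f_equal.
      extensionality k; now rewrite He. }
    rewrite transfer by exact I.
    f_equal; extensionality v; unfold eval, phi; simpl; f_equal; extensionality k.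
    now rewrite He, (Hrep (x k) (Hx k)).
Qed.

End Trees.

Theorem mainTheorem11 (L : Lang) (M N : Lstruc L) :
  aff_equiv M N ->
  exists mu nu : charge_space,
    meanable M mu /\ meanable N nu /\ pow_iso M mu N nu.
Proof.
  exact (exists_charges_pow_iso (fun b : bool => if b then M else N)).
Qed.
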